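(* Let $A, B \in \mathbb{P}_{2n}(\mathbb{R})$ and let $\mathscr{U}$ be a $2k$-dimensional symplectic subspace of $\mathbb{R}^{2n}$ that is invariant under $J(A+tB)$ for all $t\in[0,1]$. Let $\gamma_1(t)\leq\cdots\leq\gamma_k(t)$ be the symplectic eigenvalues of $A+tB$ associated with $\mathscr{U}$ for $t\in[0,1]$. Then the maps $\gamma_i:[0,1]\to\mathbb{R}$ for $i=1,\ldots,k$ are piecewise analytic.
   Context: $\mathbb{P}_{2n}(\mathbb{R})$ is the set of $2n\times 2n$ real symmetric positive definite matrices. $J = \begin{pmatrix} 0 & I_n \\ -I_n & 0\end{pmatrix}$, and $\langle\cdot,\cdot\rangle$ is the Euclidean inner product on $\mathbb{R}^{2n}$. $\operatorname{Sp}(2n)$ is the set of real $2n\times 2n$ matrices $M$ with $M^TJM=J$. By Williamson's theorem, for $A\in\mathbb{P}_{2n}(\mathbb{R})$ there is $M\in\operatorname{Sp}(2n)$ such that $M^TAM = D\oplus D$ with $D$ an $n\times n$ diagonal matrix with positive diagonal entries $d_1(A)\le\cdots\le d_n(A)$; these numbers are uniquely determined by $A$ and are called the symplectic eigenvalues of $A$. A pair $(u,v)$ of non-zero vectors in $\mathbb{R}^{2n}$ is a symplectic eigenvector pair of $A$ corresponding to a symplectic eigenvalue $d$ of $A$ if $Au = d\,Jv$ and $Av = -d\,Ju$. A subspace $\mathscr{U}$ of $\mathbb{R}^{2n}$ is a symplectic subspace if for every non-zero $u\in\mathscr{U}$ there exists $v\in\mathscr{U}$ with $\langle u,Jv\rangle\neq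 0$. A symplectic basis of a $2k$-dimensional symplectic subspace $\mathscr{U}$ is a basis $\{u_1,\ldots,u_k,v_1,\ldots,v_k\}$ of $\mathscr{U}$ with $\langle u_i,Jv_i\rangle=1$ for all $i$ and $\langle u_i,Jv_j\rangle=\langle u_i,Ju_j\rangle=\langle v_i,Jv_j\rangle=0$ for all $i\ne j$. For $A\in\mathbb{P}_{2n}(\mathbb{R})$ and a $2k$-dimensional symplectic subspace $\mathscr{U}$ invariant under $JA$, there exists a symplectic basis $\{u_1,\ldots,u_k,v_1,\ldots,v_k\}$ of $\mathscr{U}$ such that $(u_1,v_1),\ldots,(u_k,v_k)$ are symplectic eigenvector pairs of $A$ corresponding to some symplectic eigenvalues $\gamma_1\le\cdots\le\gamma_k$ of $A$; the numbers $\gamma_1,\ldots,\gamma_k$ (listed with multiplicity) are called the symplectic eigenvalues of $A$ associated with $\mathscr{U}$. A function $f:[0,1]\to\mathbb{R}$ is piecewise analytic if there exist finitely many numbers $0=a_0<a_1<\cdots<a_r=1$ such that $f$ is real analytic on each open interval $(a_{\ell-1},a_\ell)$, $\ell=1,\ldots,r$. *)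

(* Defs.v *)
From HB Require Import structures.
From mathcomp Require Import all_boot all_order all_algebra.
From mathcomp Require Import all_classical all_reals all_analysis.
Set Implicit Arguments.
Unset Strict Implicit.
Unset Printing Implicit Defensive.
Import Order.TTheory GRing.Theory Num.Theory.
Import numFieldNormedType.Exports.
Local Open Scope classical_set_scope.
Local Open Scope ring_scope.

Section Symplectic.
Variables (R : realType) (n : nat).
Implicit Types (A M : 'M[R]_(n + n)) (u v : 'cV[R]_(n + n)).
Implicit Types (U : {vspace 'cV[R]_(n + n)}).

Definition dot u v : R := (u^T *m v) 0 0.

Definition posdef A : Prop :=
  A^T = A /\ forall u, u != 0 -> 0 < dot u (A *m u).

Definition Jmx : 'M[R]_(n + n) := block_mx 0 1%:M (- 1%:M) 0.

Definition symplectic_mx M : Prop := M^T *m Jmx *m M = Jmx.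

(* [d] lists d_1(A) <= ... <= d_n(A): the diagonal of a Williamson normal form
   of [A], which does not depend on the choice of [M]. *)
Definition williamson A (d : 'rV[R]_n) : Prop :=
  [/\ forall j, 0 < d 0 j,
      forall i j : 'I_n, (i <= j)%N -> d 0 i <= d 0 j &
      exists2 M, symplectic_mx M &
        M^T *m A *m M = block_mx (diag_mx d) 0 0 (diag_mx d)].

Definition symplectic_eigenvalue A (d : R) : Prop :=
  exists2 D : 'rV[R]_n, williamson A D & exists j, d = D 0 j.

Definition symplectic_eigenpair A (d : R) u v : Prop :=
  [/\ symplectic_eigenvalue A d, u != 0, v != 0,
      A *m u = d *: (Jmx *m v) & A *m v = - d *: (Jmx *m u)].

Definition symplectic_subspace U : Prop :=
  forall u, u \in U -> u != 0 -> exists2 v, v \in U & dot u (Jmx *m v) != 0.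

Definition invariant_subspace M U : Prop :=
  forall u, u \in U -> M *m u \in U.

Definition symplectic_basis k U (u v : k.-tuple 'cV[R]_(n + n)) : Prop :=
  [/\ basis_of U (u ++ v),
      forall i, dot (tnth u i) (Jmx *m tnth v i) = 1 &
      forall i j, i != j ->
        [/\ dot (tnth u i) (Jmx *m tnth v j) = 0,
            dot (tnth u i) (Jmx *m tnth u j) = 0 &
            dot (tnth v i) (Jmx *m tnth v j) = 0]].

(* [g] is the nondecreasing list, with multiplicity, of the symplectic
   eigenvalues of [A] associated with [U]. It exists and is unique when [A] is
   positive definite and [U] is a symplectic subspace of dimension 2k that is
   invariant under [Jmx *m A]. *)
Definition associated_symplectic_eigenvalues k A U (g : 'I_k -> R) : Prop :=
  (forall i j : 'I_k, (i <= j)%N -> g i <= g j) /\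
  exists u v : k.-tuple 'cV[R]_(n + n),
    symplectic_basis U u v /\
    forall i, symplectic_eigenpair A (g i) (tnth u i) (tnth v i).

End Symplectic.

Section Analytic.
Variable R : realType.
Implicit Types f : R -> R.

Definition real_analytic_at f (x : R) : Prop :=
  exists c : R^nat, \forall y \near x, pseries c (y - x) @ \oo --> f y.

(* Only the values of [f] on the open subintervals of [0, 1] matter, so a
   function on [0, 1] may be given by any extension to [R]. *)
Definition piecewise_analytic f : Prop :=
  exists (r : nat) (a : nat -> R),
    [/\ a 0%N = 0, a r = 1 &
        forall l, (l < r)%N ->
          a l < a l.+1 /\
          forall x, a l < x < a l.+1 -> real_analytic_at f x].

End Analytic.

Arguments Jmx {R n}.

(* Main.v *)
Require Import Defs.
From HB Require Import structures.
From mathcomp Require Import all_boot all_order all_algebra.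
From mathcomp Require Import separable.
From mathcomp Require Import all_classical all_reals all_analysis.
From mathcomp Require Import ring lra.
Set Implicit Arguments.
Unset Strict Implicit.
Unset Printing Implicit Defensive.
Import Order.TTheory GRing.Theory Num.Theory.
Import numFieldNormedType.Exports.
Local Open Scope classical_set_scope.
Local Open Scope ring_scope.

(* Fix a basis of U and let T(t) be the matrix of J(A + tB) on U. On both vectors
   of a symplectic eigenvector pair the square of J(A + tB) acts as -gamma^2, so
   the characteristic polynomial of -T(t)^2, which is polynomial in t, is the
   square of prod_i (x - gamma_i(t)^2). Let Q(t, y) be its value at x = y^2.
   - The roots are bounded near t0 and a cluster point of the sorted roots as
     t -> t0 is a sorted list of roots at t0; hence each gamma_i is continuous.
   - Dividing Q(t, y) by the gcd of Q and dQ/dy, over the ring of polynomials in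
     t, gives H(t, y) that has the same roots in y as Q, all simple, except for
     finitely many t.
   - Elsewhere gamma_i is a continuous solution of H(t, gamma_i(t)) = 0 at a
     simple root, and the implicit function theorem makes it analytic.
   Since finitely many breakpoints are allowed, the exceptional t need no study. *)

(** * Weighted l^1 norms of polynomials *)

Section WeightedNorm.
Variables (R : realFieldType) (r : R).
Hypothesis r_ge0 : 0 <= r.
Implicit Types p q : {poly R}.

(** This norm is submultiplicative, dominates the values on [-r, r] and controls the tails of
    partial sums, so one estimate serves both polynomials and their values. *)
Definition wnorm p : R := \sum_(i < size p) `|p`_i| * r ^+ i.

Lemma wnorm_wide m p : (size p <= m)%N -> wnorm p = \sum_(i < m) `|p`_i| * r ^+ i.
Proof.
move=> lepm; rewrite /wnorm (big_ord_widen _ (fun i => `|p`_i| * r ^+ i) lepm).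
rewrite big_mkcond; apply: eq_bigr => i _; case: ltnP => // lepi.
by rewrite nth_default ?normr0 ?mul0r.
Qed.

Lemma wnorm_ge0 p : 0 <= wnorm p.
Proof. by apply: sumr_ge0 => i _; rewrite mulr_ge0 ?exprn_ge0. Qed.

Lemma wnorm0 : wnorm 0 = 0.
Proof. by rewrite /wnorm size_poly0 big_ord0. Qed.

Lemma wnormD p q : wnorm (p + q) <= wnorm p + wnorm q.
Proof.
rewrite (wnorm_wide (size_polyD p q)) (wnorm_wide (leq_maxl (size p) (size q))).
rewrite (wnorm_wide (leq_maxr (size p) (size q))) -big_split /=; apply: ler_sum => i _.
by rewrite coefD -mulrDl ler_wpM2r ?exprn_ge0 ?ler_normD.
Qed.

Lemma wnormZ c p : wnorm (c *: p) = `|c| * wnorm p.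
Proof.
rewrite (wnorm_wide (size_scale_leq c p)) mulr_sumr; apply: eq_bigr => i _.
by rewrite coefZ normrM mulrA.
Qed.

Lemma wnormC c : wnorm c%:P = `|c|.
Proof. by rewrite (wnorm_wide (size_polyC_leq1 c)) big_ord1 coefC mulr1. Qed.

Lemma wnormMX p : wnorm (p * 'X) = r * wnorm p.
Proof.
have le : (size (p * 'X)%R <= (size p).+1)%N.
  by apply: leq_trans (size_polyMleq _ _) _; rewrite size_polyX addn2.
rewrite (wnorm_wide le) big_ord_recl coefMX eqxx normr0 mul0r add0r mulr_sumr.
by apply: eq_bigr => i _; rewrite coefMX /= exprS mulrCA.
Qed.

Lemma wnormMXC p c : wnorm (p * 'X + c%:P) = r * wnorm p + `|c|.
Proof.
have le : (size (p * 'X + c%:P)%R <= (size p).+1)%N by rewrite size_MXaddC; case: ifP.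
rewrite (wnorm_wide le) big_ord_recl coefD coefMX coefC eqxx add0r expr0 mulr1 addrC.
congr (_ + _); rewrite mulr_sumr; apply: eq_bigr => i _.
by rewrite coefD coefMX coefC /= addr0 exprS mulrCA.
Qed.

Lemma wnormM p q : wnorm (p * q) <= wnorm p * wnorm q.
Proof.
elim/poly_ind: p => [|p c IHp]; first by rewrite mul0r wnorm0 mul0r.
rewrite wnormMXC mulrDl mulrAC (le_trans (wnormD _ _)) // mul_polyC wnormZ wnormMX.
by rewrite mulrDl lerD2r -mulrA ler_wpM2l.
Qed.

Lemma horner_wnorm p t : `|t| <= r -> `|p.[t]| <= wnorm p.
Proof.
move=> tr; rewrite horner_coef (le_trans (ler_norm_sum _ _ _)) //.
by apply: ler_sum => i _; rewrite normrM normrX ler_wpM2l // lerXn2r ?nnegrE.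
Qed.

(** Only terms of degree m + i survive, and |t|^(m + i) is at most (|t| / r)^m r^(m + i). *)
Lemma wnorm_tail p t m : 0 < r -> `|t| <= r ->
  `|\sum_(i < m) p`_i * t ^+ i - p.[t]| <= (`|t| / r) ^+ m * wnorm p.
Proof.
move=> r_gt0 tr; rewrite (horner_coef_wide t (leq_addl m (size p))).
rewrite (wnorm_wide (leq_addl m (size p))) !big_split_ord /= opprD addNKr normrN.
rewrite mulrDr (le_trans (ler_norm_sum _ _ _)) // ler_wpDl //.
  by rewrite mulr_ge0 ?sumr_ge0 // => [|i _]; rewrite ?mulr_ge0 ?exprn_ge0 ?divr_ge0.
rewrite mulr_sumr; apply: ler_sum => i _.
rewrite normrM normrX mulrCA ler_wpM2l // !exprD expr_div_n mulrA divfK.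
  by rewrite ler_wpM2l ?exprn_ge0 // lerXn2r ?nnegrE.
by rewrite expf_neq0 ?gt_eqF.
Qed.
End WeightedNorm.

(** * Contraction estimates, in norm and X-adically *)

Section Contraction.
Variable R : realFieldType.
Implicit Types (p q : {poly R}) (F G : {poly {poly R}}).

Lemma wnorm_mono (r s : R) p : 0 <= r -> r <= s -> wnorm r p <= wnorm s p.
Proof.
move=> r0 rs; apply: ler_sum => i _; rewrite ler_wpM2l //.
by rewrite lerXn2r ?nnegrE // (le_trans r0).
Qed.

Lemma horner_subM (A : comNzRingType) (G : {poly A}) (p q : A) :
  exists h, G.[p] - G.[q] = (p - q) * h.
Proof.
elim/poly_ind: G => [|G c [h hE]]; first by exists 0; rewrite !horner0 subrr mulr0.
by exists (h * p + G.[q]); rewrite !hornerMXaddC mulrDr mulrA -hE; ring.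
Qed.

(** The bound is uniform in r, which allows [order2_contraction] to fix the radius after g is
    known. *)
Lemma wnorm_horner_le G : exists2 g : R, 0 <= g &
  forall r p, 0 <= r <= 1 -> wnorm r p <= 1 -> wnorm r G.[p] <= g.
Proof.
elim/poly_ind: G => [|G c [g g0 IH]].
  by exists 0 => // r p _ _; rewrite horner0 wnorm0.
exists (g + wnorm 1 c) => [|r p r01 p1]; first by rewrite addr_ge0 ?wnorm_ge0.
have /andP[r0 r1] := r01; rewrite hornerMXaddC (le_trans (wnormD r0 _ _)) //.
rewrite lerD ?wnorm_mono // (le_trans (wnormM r0 _ _)) //.
by rewrite -[g]mulr1 ler_pM ?wnorm_ge0 ?IH.
Qed.

Lemma wnorm_horner_lip G : exists2 l : R, 0 <= l & forall r p q, 0 <= r <= 1 ->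
  wnorm r p <= 1 -> wnorm r q <= 1 -> wnorm r (G.[p] - G.[q]) <= l * wnorm r (p - q).
Proof.
elim/poly_ind: G => [|G c [l l0 IH]].
  by exists 0 => // r p q _ _ _; rewrite !horner0 subrr wnorm0 mul0r.
have [g g0 gP] := wnorm_horner_le G.
exists (l + g) => [|r p q r01 p1 q1]; first exact: addr_ge0.
have /andP[r0 r1] := r01; rewrite !hornerMXaddC.
have -> : G.[p] * p + c - (G.[q] * q + c) = (G.[p] - G.[q]) * p + G.[q] * (p - q) by ring.
rewrite [leRHS]mulrDl (le_trans (wnormD r0 _ _)) // lerD ?(le_trans (wnormM r0 _ _)) //.
  by rewrite -[leRHS]mulr1 ler_pM ?wnorm_ge0 ?IH.
by rewrite ler_wpM2r ?wnorm_ge0 ?gP.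
Qed.

(** With t the inner and y the outer variable, the hypotheses kill the terms 1 and y, leaving a(t) t
    + b(t) t y + G(t, y) y^2. *)
Lemma order2_decomp F : F`_0`_0 = 0 -> F`_1`_0 = 0 ->
  exists a b G, F = (G * 'X + (b * 'X)%:P) * 'X + (a * 'X)%:P.
Proof.
have dropX (A : nzRingType) (p : {poly A}) : p = drop_poly 1 p * 'X + (p`_0)%:P.
  apply/polyP => -[|i]; rewrite !coefE //= ?add0r ?addr0 //.
  by rewrite addn1.
move=> F0 F1; exists (drop_poly 1 F`_0), (drop_poly 1 F`_1), (drop_poly 1 (drop_poly 1 F)).
rewrite {1}[F]dropX {1}[drop_poly 1 F]dropX coef_drop_poly.
by rewrite {1}[F`_0]dropX {1}[F`_1]dropX F0 F1 !addr0.
Qed.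

(** Every difference comes with a factor ['X], p + q or q * q; these are small in norm and divisible
    by ['X], as the two contractions below require. *)
Lemma order2_sub a b G p q (F := (G * 'X + (b * 'X)%:P) * 'X + (a * 'X)%:P) :
  F.[p] - F.[q] =
    (p - q) * (b * 'X + (p + q) * G.[p]) + q * q * (G.[p] - G.[q]).
Proof. by rewrite !hornerMXaddC; ring. Qed.

Lemma order2_contraction F : F`_0`_0 = 0 -> F`_1`_0 = 0 ->
  exists r s : R, [/\ 0 < r <= 1, 0 < s <= 1, wnorm r F.[0] <= s / 2 &
    forall p q, wnorm r p <= s -> wnorm r q <= s ->
      wnorm r (F.[p] - F.[q]) <= wnorm r (p - q) / 2].
Proof.
move=> F0 F1; have [a [b [G ->]]] := order2_decomp F0 F1.
have [g g0 gP] := wnorm_horner_le G; have [l l0 lP] := wnorm_horner_lip G.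
set wa := wnorm 1 a; set wb := wnorm 1 b.
have wa0 : 0 <= wa by exact: wnorm_ge0.
have wb0 : 0 <= wb by exact: wnorm_ge0.
(* First s makes the contributions of G small, then r those of a and b relative to s: r wa <= s / 2
   bounds [F.[0]], and r wb + 2 s g + s l <= 1 / 2 is the contraction factor. *)
pose s := (8 * (g + l + 1))^-1; pose r := s / (2 * (wa + wb + 1)).
have sE : s * (g + l + 1) = 8^-1.
  by rewrite /s invfM -mulrA mulVf ?mulr1 // gt_eqF //; lra.
have rE : r * (wa + wb + 1) = s / 2.
  by rewrite /r invfM -!mulrA mulVf ?mulr1 // gt_eqF //; lra.
have s0 : 0 < s by rewrite /s invr_gt0; lra.
have r0 : 0 < r by rewrite /r divr_gt0 //; lra.
have sg := mulr_ge0 (ltW s0) g0; have sl := mulr_ge0 (ltW s0) l0.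
have ra := mulr_ge0 (ltW r0) wa0; have rb := mulr_ge0 (ltW r0) wb0.
have s1 : s <= 1 by lra.
have r1 : r <= 1 by lra.
have r01 : 0 <= r <= 1 by rewrite ltW.
have r0' := ltW r0; have s0' := ltW s0.
exists r, s; rewrite r0 s0 r1 s1; split=> // [|p q ps qs].
  rewrite hornerMXaddC mulr0 add0r wnormMX //.
  have : r * wnorm r a <= r * wa by rewrite ler_wpM2l ?wnorm_mono.
  lra.
rewrite order2_sub (le_trans (wnormD r0' _ _)) //.
set w := wnorm r (p - q); have w0 : 0 <= w by exact: wnorm_ge0.
have h1 : wnorm r (b * 'X + (p + q) * G.[p]) <= r * wb + 2 * s * g.
  rewrite (le_trans (wnormD r0' _ _)) // lerD //.
    by rewrite wnormMX // ler_wpM2l // wnorm_mono.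
  rewrite (le_trans (wnormM r0' _ _)) // ler_pM ?wnorm_ge0 ?gP ?(le_trans ps) //.
  by rewrite (le_trans (wnormD r0' _ _)) //; lra.
have h2 : wnorm r (q * q * (G.[p] - G.[q])) <= s * (l * w).
  rewrite (le_trans (wnormM r0' _ _)) // ler_pM ?wnorm_ge0 ?lP ?(le_trans ps) ?(le_trans qs) //.
  by rewrite (le_trans (wnormM r0' _ _)) // -[s]mulr1 ler_pM ?wnorm_ge0 ?(le_trans qs).
have h3 : wnorm r ((p - q) * (b * 'X + (p + q) * G.[p])) <= w * (r * wb + 2 * s * g).
  by rewrite (le_trans (wnormM r0' _ _)) // ler_wpM2l.
have : w * (r * wb + 2 * s * g + s * l) <= w * 2^-1 by rewrite ler_wpM2l //; lra.
lra.
Qed.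

(** By [order2_sub] and [horner_subM] the difference is p - q times a cofactor, and all terms of
    that cofactor are divisible by ['X]. *)
Lemma order2_dvd F p q n : F`_0`_0 = 0 -> F`_1`_0 = 0 ->
  'X %| p -> 'X %| q -> 'X^n %| p - q -> 'X^(n.+1) %| F.[p] - F.[q].
Proof.
move=> F0 F1 Xp Xq Xpq; have [a [b [G ->]]] := order2_decomp F0 F1.
rewrite order2_sub exprSr; have [h ->] := horner_subM G p q.
rewrite (mulrCA (q * q)); apply: dvdp_add; apply: dvdp_mul => //.
  by apply: dvdp_add; rewrite ?dvdp_mulIr // dvdp_mulr // dvdp_add.
by rewrite !dvdp_mulr.
Qed.

End Contraction.

(** * Power series solutions of polynomial equations *)

Lemma coef_dvdXn (F : fieldType) (p : {poly F}) n i : 'X^n %| p -> (i < n)%N -> p`_i = 0.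
Proof. by move=> /dvdpP[q ->] ltin; rewrite coefMXn ltin. Qed.

Lemma horner2C (A : comNzRingType) (F : {poly {poly A}}) (p : {poly A}) t :
  F.[p].[t] = F.[p.[t]%:P].[t].
Proof.
by elim/poly_ind: F => [|F c IH]; rewrite ?horner0 // !hornerMXaddC !hornerE IH.
Qed.

(* The series is the limit of the Picard iterates of [F] from 0: they stay
   bounded in the weighted l^1 norm, and [X]-adic contraction makes their
   coefficients stabilize. *)
Lemma fixpoint_pseries (R : realType) (F : {poly {poly R}}) :
    F`_0`_0 = 0 -> F`_1`_0 = 0 ->
  exists r s (c : R^nat), [/\ 0 < r, 0 < s, c 0%N = 0 &
    forall t y, `|t| < r -> `|y| <= s -> y = F.[y%:P].[t] ->
      pseries c t @ \oo --> y].
Proof.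
move=> F0 F1; have [r [s [/andP[r0 _] /andP[s0 _] Fs Flip]]] := order2_contraction F0 F1.
have r0' := ltW r0.
pose p n := iter n (horner F) 0.
have ps n : wnorm r (p n) <= s.
  elim: n => [|n IH]; first by rewrite wnorm0 ltW.
  rewrite /= -[F.[_]](subrK F.[0]) (le_trans (wnormD r0' _ _)) //.
  have := Flip _ 0 IH; rewrite wnorm0 subr0 => /(_ (ltW s0)); rewrite /p; lra.
have Xp n : 'X %| p n.
  elim: n => [|n IH]; first exact: dvdp0.
  have := order2_dvd F0 F1 IH (dvdp0 _) (dvd1p _ : 'X^0%N %| _).
  rewrite expr1 => XF; rewrite /= -[F.[_]](subrK F.[0]) dvdp_add //.
  apply/dvdpP; exists (drop_poly 1 F`_0); rewrite horner_coef0.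
  by apply/polyP => -[|i]; rewrite !coefE //= addn1.
have Xpp n m : 'X^n %| p (n + m)%N - p n.
  elim: n => [|n IH]; first exact: dvd1p.
  exact: order2_dvd.
(* Iterates from the (n+1)-st on agree modulo X^(n+1), so this is the stable coefficient of X^n. *)
pose c n := (p n.+1)`_n.
exists r, s, c; split=> // [|t y tr ys yE].
  by rewrite /c (@coef_dvdXn _ _ 1) // expr1.
(* The numbers (p n).[t] and y lie in the s-ball as constant polynomials; the contraction applies to
   them, and evaluation at t makes y a fixed point. *)
have yerr n : `|(p n).[t] - y| <= s * 2^-1 ^+ n.
  elim: n => [|n IH]; first by rewrite horner0 sub0r normrN mulr1.
  have pns : wnorm r (p n).[t]%:P <= s.
    by rewrite wnormC (le_trans _ (ps n)) // horner_wnorm // ltW.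
  have yns : wnorm r y%:P <= s by rewrite wnormC.
  have := Flip _ _ pns yns; rewrite -polyCB wnormC => H.
  have -> : (p n.+1).[t] - y = (F.[(p n).[t]%:P] - F.[y%:P]).[t].
    by rewrite hornerD hornerN -yE -horner2C.
  rewrite exprSr (le_trans (horner_wnorm r0' _ (ltW tr))) // (le_trans H) //.
  by rewrite mulrA ler_wpM2r // invr_ge0.
have cE n : pseries c t n = \sum_(i < n) (p n)`_i * t ^+ i.
  rewrite /pseries /series /= big_mkord; apply: eq_bigr => i _; congr (_ * _).
  have := coef_dvdXn (Xpp i.+1 (n - i.+1)%N) (ltnSn i); rewrite subnKC // coefB.
  by move=> /subr0_eq ->.
have tr1 : `|t| / r < 1 by rewrite ltr_pdivrMr ?mul1r.
have t0 : 0 <= `|t| / r by rewrite divr_ge0.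
apply: cvg_zero; apply/norm_cvg0P.
(* The two geometric terms bound the truncation error of [p n] and its distance to y at t. *)
apply: (@squeeze_cvgr _ _ _ _ (cst 0) (fun n => (`|t| / r) ^+ n * s + s * 2^-1 ^+ n)).
- apply: nearW => n; rewrite normr_ge0 /=.
  have -> : (pseries c t - cst y) n = \sum_(i < n) (p n)`_i * t ^+ i - y by rewrite -cE.
  rewrite -(subrK (p n).[t] (\sum_(i < n) _)) -addrA (le_trans (ler_normD _ _)) // lerD //.
  by rewrite (le_trans (wnorm_tail r0' _ _ r0 (ltW tr))) // ler_wpM2l ?exprn_ge0.
- exact: cvg_cst.
- rewrite -[X in _ --> X](addr0 0) -{1}(mul0r s) -{2}(mulr0 s); apply: cvgD.
    by apply: cvgMl; apply: cvg_expr; rewrite ger0_norm.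
  by apply: cvgMr; apply: cvg_expr; rewrite ger0_norm ?invf_lt1 ?invr_ge0 //; lra.
Qed.

(** After (t0, g t0) is moved to the origin, the Newton map y - S(t, y) / b has neither a constant
    nor a pure y term. The translated g is a fixed point of it, and continuity keeps g in the ball
    where [fixpoint_pseries] applies. *)
Lemma implicit_real_analytic (R : realType) (P : {poly {poly R}}) (g : R -> R) t0 :
    {for t0, continuous g} -> (\forall t \near t0, P.[(g t)%:P].[t] = 0) ->
  P^`().[(g t0)%:P].[t0] != 0 -> real_analytic_at g t0.
Proof.
move=> g_cont P0; set b := _.[t0] => b0; set y0 := g t0.
pose shift := comp_poly ('X + t0%:P) : {rmorphism {poly R} -> {poly R}}.
pose S := map_poly shift (P \Po ('X + y0%:P%:P)).
have shiftC c : shift c%:P = c%:P by rewrite /shift /= comp_polyC.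
have SE Q y t : (map_poly shift (Q \Po ('X + y0%:P%:P))).[y%:P].[t] = Q.[(y + y0)%:P].[t + t0].
  by rewrite -[y%:P in LHS]shiftC horner_map /= horner_comp !hornerE horner_comp !hornerE polyCD.
have SE0 Q : (map_poly shift (Q \Po ('X + y0%:P%:P))).[0].[0] = Q.[y0%:P].[t0].
  by have := SE Q 0 0; rewrite polyC0 !add0r.
pose F := 'X - b^-1%:P%:P * S.
have F0 : F`_0`_0 = 0.
  rewrite -!horner_coef0 /F !hornerE SE0.
  by rewrite (nbhs_singleton P0) mulr0 oppr0.
have F1 : F`_1`_0 = 0.
  have -> : F`_1 = F^`().[0] by rewrite horner_coef0 coef_deriv.
  rewrite -horner_coef0 /F derivB derivX derivM derivC mul0r add0r.
  rewrite !hornerE deriv_map deriv_comp derivD derivX derivC addr0 mulr1.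
  by rewrite SE0 mulVf // subrr.
have [r [s [c [r0 s0 c0 cP]]]] := fixpoint_pseries F0 F1.
exists (fun n => c n + y0 *+ (n == 0)%N).
have gs : \forall t \near t0, `|y0 - g t| <= s.
  by have /cvgrPdist_le := g_cont; apply.
have tr : \forall t \near t0, `|t0 - t| < r.
  by have /cvgrPdist_lt := @cvg_id _ (nbhs t0); apply.
near=> t.
have Pt : P.[(g t)%:P].[t] = 0 by near: t.
have : pseries c (t - t0) @ \oo --> g t - y0.
  apply: cP; first by rewrite distrC; near: t.
    by rewrite distrC; near: t.
  by rewrite /F !hornerE SE !subrK Pt mulr0 subr0.
move=> /(cvgD (cvg_cst y0)); rewrite subrKC; apply: cvg_trans; apply: near_eq_cvg.
near=> n; rewrite /pseries /series /= !fctE.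
(* The empty partial sum lacks the constant term y0. *)
have n0 : (0 < n)%N by near: n; exact: nbhs_infty_gt.
under [RHS]eq_bigr do rewrite mulrDl.
rewrite big_split /= addrC; congr (_ + _).
by rewrite -(prednK n0) big_nat_recl // big1 ?mulr1 ?addr0 // => i _; rewrite mul0r.
Unshelve. all: by end_near.
Qed.

(** * Specialization of the square-free part *)

Lemma horner_map_eval (A : comNzRingType) (P : {poly {poly A}}) (t x : A) :
  (map_poly (horner_eval t) P).[x] = P.[x%:P].[t].
Proof. by rewrite -[x in LHS](hornerC x t) horner_map. Qed.

(** If x were not a root of h, its full multiplicity in q would pass to g and hence to the
    derivative of q, where in characteristic zero the multiplicity is one less. The scalars a and b
    come from pseudo-division. *)
Lemma root_cofactor (F : numFieldType) (q h g l : {poly F}) a b x :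
    a != 0 -> b != 0 -> q != 0 -> a *: q = h * g -> b *: q^`() = l * g ->
  root q x -> root h x.
Proof.
move=> a0 b0 q0 qE q'E qx; apply: contraT => hx.
have [m [q1]] := multiplicity_XsubC q x; rewrite q0 /= => q1x qm.
case: m qm => [|m] qm; first by rewrite qm mulr1 (negPf q1x) in qx.
have : ('X - x%:P) ^+ m.+1 %| g.
  have : ('X - x%:P) ^+ m.+1 %| h * g by rewrite -qE qm dvdpZr // dvdp_mull.
  by rewrite Gauss_dvdpr // coprimep_expl // coprimep_sym coprimep_XsubC.
move=> /(dvdp_mull l); rewrite -q'E dvdpZr // qm derivM.
rewrite dvdp_addr; last by rewrite dvdp_mull.
rewrite deriv_exp derivXsubC mul1r mulrnAr -mulrnAl /= exprS.
rewrite dvdp_mul2r ?expf_neq0 ?polyXsubC_eq0 // dvdp_XsubCl /root hornerMn mulrn_eq0 /=.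
by rewrite -[_ == 0]/(root q1 x) (negPf q1x).
Qed.

Lemma squarefree_part (R : realFieldType) (Q : {poly {poly R}}) : Q != 0 ->
  exists H : {poly {poly R}},
    exists2 D : {poly R}, D != 0 & forall t x, D.[t] != 0 -> Q.[x%:P].[t] = 0 ->
      H.[x%:P].[t] = 0 /\ H^`().[x%:P].[t] != 0.
Proof.
move=> Q0; set G := gcdp Q Q^`(); set H := Q %/ G.
(* Pseudo-division over [{poly R}]: the quotient identities hold up to factors in t. *)
have qE := Pdiv.Idomain.divpK (dvdp_gcdl Q Q^`()).
have q'E := Pdiv.Idomain.divpK (dvdp_gcdr Q Q^`()).
rewrite -/G -/H in qE q'E; set L := _ %/ _ in q'E.
set a := _ ^+ _ in qE; set b := _ ^+ _ in q'E.
have G0 : G != 0 by rewrite gcdp_eq0 negb_and Q0.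
have a0 : a != 0 by rewrite expf_neq0 ?lead_coef_eq0.
have b0 : b != 0 by rewrite expf_neq0 ?lead_coef_eq0.
have := make_separable Q0; rewrite -/G -/H unlock => /Pdiv.Idomain.Bezout_coprimepP[[u v]] /=.
rewrite -size_poly_eq1 => /size_poly1P[c c0 cE].
(* Off the zeros of D, specialization at t behaves well: a and b keep the divisions valid, c keeps H
   and its derivative coprime, and the leading coefficient keeps Q(t, .) non-zero. *)
exists H, (a * b * c * lead_coef Q); first by rewrite !mulf_neq0 ?lead_coef_eq0.
move=> t x; rewrite !hornerM !mulf_eq0 !negb_or => /andP[/andP[/andP[at0 bt0] ct0] lt0] Qtx.
pose ev := map_poly (horner_eval t).
have Hx : H.[x%:P].[t] = 0.
  rewrite -horner_map_eval; apply/rootP.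
  apply: (@root_cofactor _ (ev Q) _ (ev G) (ev L) a.[t] b.[t]) => //.
  - by apply: contraNneq lt0 => /polyP/(_ (size Q).-1); rewrite coef_map coef0 => /= <-.
  - by rewrite -rmorphM qE /= /ev map_polyZ.
  - by rewrite deriv_map -rmorphM q'E /= /ev map_polyZ.
  - by apply/rootP; rewrite horner_map_eval.
split=> //; apply: contra_neq ct0 => H'x.
have := congr1 (fun p => p.[x%:P].[t]) cE.
by rewrite !hornerE Hx H'x !mulr0 addr0.
Qed.

(** * Continuity of sorted roots *)

Lemma poly_horner_inj (R : numFieldType) (p q : {poly R}) : horner p =1 horner q -> p = q.
Proof.
move=> pq; apply/eqP; rewrite -subr_eq0; apply/eqP.
apply: (@roots_geq_poly_eq0 _ _ [seq i%:R | i <- iota 0 (size (p - q))]).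
- by apply/allP => x _; rewrite rootE hornerD hornerN pq subrr.
- by rewrite map_inj_uniq ?iota_uniq // => i j /eqP; rewrite eqr_nat => /eqP.
- by rewrite size_map size_iota.
Qed.

(** Equal squares give equal products up to sign, and monicity excludes the minus sign. The root
    lists are then permutations of each other, and both are sorted. *)
Lemma sorted_roots_inj (R : realFieldType) k (p q : 'I_k -> R) :
    (forall i j : 'I_k, (i <= j)%N -> p i <= p j) ->
    (forall i j : 'I_k, (i <= j)%N -> q i <= q j) ->
    (forall x, (\prod_i (x - p i)) ^+ 2 = (\prod_i (x - q i)) ^+ 2) ->
  p =1 q.
Proof.
move=> ps qs pq.
pose P (f : 'I_k -> R) := \prod_(x <- codom f) ('X - x%:P).
have PE f x : (P f).[x] = \prod_i (x - f i).
  rewrite /P big_image horner_prod; apply: eq_bigr => i _.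
  by rewrite hornerXsubC.
have : P p ^+ 2 = P q ^+ 2 by apply: poly_horner_inj => x; rewrite !horner_exp !PE.
move=> /eqP; rewrite eqf_sqr => /orP[|] /eqP Ppq; last first.
  have := congr1 lead_coef Ppq; rewrite lead_coefN !lead_coef_prod_XsubC => /eqP.
  by rewrite eq_sym eqNr oner_eq0.
have sorted_codom f : (forall i j : 'I_k, (i <= j)%N -> f i <= f j) -> sorted <=%R (codom f).
  move=> fs; rewrite /codom sorted_map; apply: (@sub_sorted _ (fun i j : 'I_k => (i <= j)%N)).
    by move=> i j; apply: fs.
  have := iota_sorted 0 k; rewrite -val_enum_ord sorted_map; exact.
have : codom p = codom q.
  by apply: (sorted_eq le_trans le_anti); rewrite ?sorted_codom //; apply: prod_XsubC_eq.
by move=> /eq_in_map H i; apply: H; rewrite mem_enum.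
Qed.

Lemma continuous_prodB (R : realType) k (x : R) :
  continuous (fun v : 'rV[R]_k => (\prod_i (x - v 0 i)) ^+ 2).
Proof.
move=> v; apply: (@continuous_comp _ _ _
  (fun v : 'rV[R]_k => \prod_i (x - v 0 i)) (fun z => z ^+ 2)).
  2: exact: exprn_continuous.
elim: (index_enum _) => [|i s IH].
  have -> : (fun w : 'rV[R]_k => \prod_(i <- [::]) (x - w 0 i)) = cst 1.
    by apply/funext => w; rewrite big_nil.
  exact: cst_continuous.
have -> : (fun w : 'rV[R]_k => \prod_(j <- i :: s) (x - w 0 j)) =
    (fun w => (x - w 0 i) * \prod_(j <- s) (x - w 0 j)).
  by apply/funext => w; rewrite big_cons.
apply: continuousM => //; apply: continuousB; first exact: cst_continuous.
exact: coord_continuous.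
Qed.

Lemma sorted_roots_continuous (R : realType) k (Q : {poly {poly R}}) (g : 'I_k -> R -> R) t0 :
    (\forall t \near t0, [/\ forall i j : 'I_k, (i <= j)%N -> g i t <= g j t,
      forall i, 0 <= g i t & forall x, Q.[x%:P].[t] = (\prod_i (x - g i t)) ^+ 2]) ->
  forall i, {for t0, continuous (g i)}.
Proof.
case: k g => [|k] g Hg i; first by case: i.
pose G t : 'rV[R]_k.+1 := \row_j g j t.
have [s0 p0 Q0] := nbhs_singleton Hg.
suff : G @ t0 --> G t0.
  move=> GG; have := cvg_comp G _ GG (@coord_continuous _ _ _ 0 i (G t0)).
  rewrite /continuous_at mxE; apply: cvg_trans.
  by apply: near_eq_cvg; apply: nearW => t; rewrite /= mxE.
set M := Q.[(-1)%:P].[t0] + 1.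
(* The roots being non-negative, at x = -1 each squared factor is at least 1, so the value of Q
   dominates every (1 + g j t)^2. *)
have leM t : (forall j, 0 <= g j t) -> (forall x, Q.[x%:P].[t] = (\prod_i (x - g i t)) ^+ 2) ->
    forall j, g j t <= Q.[(-1)%:P].[t].
  move=> gt0 Qt j; rewrite Qt (bigD1 j) //= exprMn.
  have ge1 : 1 <= (\prod_(l < k.+1 | l != j) (-1 - g l t)) ^+ 2.
    rewrite -prodrXl; elim/big_ind: _ => // [x y x1 y1|l _].
      by rewrite -[1]mulr1 ler_pM.
    by have := gt0 l; nra.
  have := gt0 j; nra.
have contQ x : Q.[x%:P].[t] @[t --> t0] --> Q.[x%:P].[t0] by apply: continuous_horner.
have nearM : \forall t \near t0, Q.[(-1)%:P].[t] <= M.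
  by apply: (cvgr_le _ (contQ (-1))); rewrite /M ltrDl.
have nearG : \forall t \near t0, forall j, 0 <= g j t <= M.
  near=> t; have [_ p Qt] : [/\ forall i j : 'I_k.+1, (i <= j)%N -> g i t <= g j t,
      forall i, 0 <= g i t & forall x, Q.[x%:P].[t] = (\prod_i (x - g i t)) ^+ 2] by near: t.
  by move=> j; rewrite p; apply: (le_trans (leM t p Qt j)); near: t.
(* The box exceeds [0, M] on both sides so as to be a neighbourhood of [G t0]. *)
pose V := [set v : 'rV[R]_k.+1 | forall j, v 0 j \in `[-1, M + 1]].
have clG p (A : set 'rV[R]_k.+1) :
    cluster (G @ t0) p -> closed A -> (\forall t \near t0, A (G t)) -> A p.
  by rewrite clusterE => pG clA FA; apply/clA/pG.
apply: (@compact_cluster_set1 _ _ _ V).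
- exact: norm_hausdorff.
- by apply: (@rV_compact _ _ (fun=> [set` `[-1, M + 1]])) => j; apply: segment_compact.
- apply: (@filter_forall _ _ (fun j (v : 'rV[R]_k.+1) => v 0 j \in `[-1, M + 1]) _ (nbhs_filter _)) => j.
  have /(_ j)/andP[g0 gM] := nbhs_singleton nearG.
  suff nb : \forall y \near G t0 0 j, y \in `[-1, M + 1].
    exact: (@coord_continuous _ _ _ 0 j (G t0) _ nb).
  rewrite mxE; have : \forall y \near g j t0, y \in `]-1, M + 1[.
    by apply: near_in_itvoo; rewrite in_itv /=; lra.
  by apply: filterS => y; rewrite !in_itv /= => /andP[/ltW -> /ltW ->].
- by apply: fmap_proper_filter; apply: nbhs_pfilter.
- suff : \forall t \near t0, V (G t) by [].
  near=> t => j; have gt : forall j, 0 <= g j t <= M by near: t.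
  by have /andP[g0 gM] := gt j; rewrite mxE in_itv /=; lra.
- apply/seteqP; split=> [p pG|p ->].
    apply/rowP => j; rewrite mxE.
    apply: (@sorted_roots_inj _ _ (fun j => p 0 j) (g^~ t0)) => // [a b ab|x].
      rewrite -subr_ge0; apply: (clG _ [set v : 'rV[R]_k.+1 | 0 <= v 0 b - v 0 a] pG).
        pose f (v : 'rV[R]_k.+1) := v 0 b - v 0 a.
        have cf : continuous f by move=> v; apply: continuousB; apply: coord_continuous.
        exact: (@preimage_closed _ _ f _ (fun v _ => cf v) (@closed_ge _ 0)).
      near=> t; rewrite /= !mxE subr_ge0; near: t; apply: filterS Hg => t [gs _ _]; exact: gs.
    (* The values of Q move with t, so [G t] need not satisfy the equation at t0; it does satisfy
       each closed e-approximation for t near t0. *)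
    apply: etrans (Q0 x); apply/eqP; rewrite -subr_eq0 -normr_le0.
    apply/ler_addgt0Pr => e e0; rewrite add0r.
    apply: (clG _ [set v : 'rV[R]_k.+1 | `|(\prod_i (x - v 0 i)) ^+ 2 - Q.[x%:P].[t0]| <= e] pG).
      pose f (v : 'rV[R]_k.+1) := (\prod_i (x - v 0 i)) ^+ 2 - Q.[x%:P].[t0].
      have cf : continuous f.
        move=> v; apply: (@continuousB _ _ _ (fun v : 'rV[R]_k.+1 => (\prod_i (x - v 0 i)) ^+ 2)).
          exact: continuous_prodB.
        exact: cst_continuous.
      have cnf : continuous (fun v => `|f v|).
        by move=> v; apply: (continuous_comp (cf v)); apply: norm_continuous.
      exact: (@preimage_closed _ _ (fun v => `|f v|) _ (fun v _ => cnf v) (@closed_le _ e)).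
    have Qx : \forall t \near t0, Q.[x%:P].[t] = (\prod_i (x - g i t)) ^+ 2.
      by apply: filterS Hg => t [_ _].
    have Qe : \forall t \near t0, `|Q.[x%:P].[t] - Q.[x%:P].[t0]| <= e.
      exact: cvgr_distC_le (contQ x) _ e0.
    near=> t; rewrite /=; under [X in `|X ^+ 2 - _|]eq_bigr do rewrite mxE.
    by rewrite -(near Qx t) //; near: t.
  (* The filter at t0 is not punctured, so [G t0] itself is a cluster point. *)
  move=> A B FA nB; exists (G t0); split; last exact: nbhs_singleton.
  exact: (nbhs_singleton FA).
Unshelve. all: by end_near.
Qed.

(** * Characteristic polynomial on the invariant subspace *)

Lemma horner_char_poly (A : comNzRingType) d (M : 'M[A]_d) x :
  (char_poly M).[x] = \det (x%:M - M).
Proof.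
rewrite /char_poly -[LHS]/(horner_eval x _) -det_map_mx; congr (\det _).
by apply/matrixP => i j; rewrite !mxE /= /horner_eval hornerD hornerN hornerMn hornerX hornerC.
Qed.

Lemma char_poly_diagonalizable (F : fieldType) d (T E : 'M[F]_d) (D : 'rV[F]_d) x :
  row_free E -> E *m T = diag_mx D *m E -> (char_poly T).[x] = \prod_i (x - D 0 i).
Proof.
move=> Efree ET; rewrite horner_char_poly.
have E0 : \det E != 0 by rewrite -unitfE -unitmxE -row_free_unit.
apply: (mulfI E0); rewrite -det_mulmx mulmxBr ET mul_mx_scalar -mul_scalar_mx -mulmxBl.
rewrite det_mulmx mulrC; congr (_ * _).
have -> : x%:M - diag_mx D = diag_mx (\row_i (x - D 0 i)).
  by apply/matrixP => i j; rewrite !mxE mulrnBl.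
by rewrite det_diag; apply: eq_bigr => i _; rewrite mxE.
Qed.

Section RowMatrix.
Variables (F : fieldType) (m d : nat).
Implicit Types (X : d.-tuple 'cV[F]_m) (U : {vspace 'cV[F]_m}).

(** Bases of U consist of columns while matrix spaces are row spaces; hence the transposition, with
    operators acting by their transposes on the right. *)
Definition rows_mx X : 'M[F]_(d, m) := \matrix_(i, j) tnth X i j 0.

Lemma row_rows_mx X i : row i (rows_mx X) = (tnth X i)^T.
Proof. by apply/rowP => j; rewrite !mxE. Qed.

Lemma mul_rows_mx X (c : 'rV[F]_d) : c *m rows_mx X = (\sum_i c 0 i *: X`_i)^T.
Proof.
rewrite mulmx_sum_row linear_sum; apply: eq_bigr => i _.
by rewrite row_rows_mx linearZ /= (tnth_nth 0).
Qed.

Lemma basis_row_free U X : basis_of U X -> row_free (rows_mx X).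
Proof.
move=> /basis_free/freeP freeX; apply: inj_row_free => c.
rewrite mul_rows_mx => /(congr1 trmx); rewrite trmxK trmx0 => /freeX c0.
by apply/rowP => i; rewrite c0 mxE.
Qed.

Lemma basis_sub_rows U X w : basis_of U X -> w \in U -> (w^T <= rows_mx X)%MS.
Proof.
move=> /span_basis <- /coord_span wE.
have -> : w^T = (\row_i coord X i w) *m rows_mx X.
  by rewrite mul_rows_mx {1}wE; congr (_^T); apply: eq_bigr => i _; rewrite mxE.
exact: submxMl.
Qed.

End RowMatrix.

Lemma Jmx_sqr (R : realType) n : Jmx *m Jmx = - 1%:M :> 'M[R]_(n + n).
Proof.
rewrite /Jmx mulmx_block !mul0mx !mulmx0 !mul1mx !mulmx1 !add0r !addr0.
by rewrite -[RHS]scaleN1r scalar_mx_block scale_block_mx !scaler0 !scaleN1r.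
Qed.

(** S sends u to -d v and v to d u, so its square acts on both by a real scalar. *)
Lemma eigenpair_sqr (R : realType) n (A : 'M[R]_(n + n)) d u v
    (S := Jmx *m A) : symplectic_eigenpair A d u v ->
  [/\ 0 < d, S *m (S *m u) = - d ^+ 2 *: u & S *m (S *m v) = - d ^+ 2 *: v].
Proof.
move=> [[D [D0 _ _] [j ->]] _ _ Au Av].
have Su : S *m u = - D 0 j *: v.
  by rewrite /S -mulmxA Au -scalemxAr mulmxA Jmx_sqr mulNmx mul1mx scalerN scaleNr.
have Sv : S *m v = D 0 j *: u.
  by rewrite /S -mulmxA Av -scalemxAr mulmxA Jmx_sqr mulNmx mul1mx scalerN scaleNr opprK.
split=> //; rewrite (Su, Sv) -scalemxAr (Su, Sv) scalerA; congr (_ *: _); ring.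
Qed.

Section SymplecticSpectrum.
Variables (R : realType) (n k : nat) (A B : 'M[R]_(n + n)).
Variables (U : {vspace 'cV[R]_(n + n)}) (gamma : 'I_k -> R -> R).
Hypothesis invU : forall t : R, 0 <= t <= 1 -> invariant_subspace (Jmx *m (A + t *: B)) U.
Hypothesis gammaE : forall t : R, 0 <= t <= 1 ->
  associated_symplectic_eigenvalues (A + t *: B) U (fun i => gamma i t).

Lemma symplectic_spectrum_poly : exists2 Q : {poly {poly R}}, Q != 0 &
  forall t x, 0 <= t <= 1 -> Q.[x%:P].[t] = (\prod_i (x - gamma i t ^+ 2)) ^+ 2.
Proof.
have [_ [u0 [v0 [[basis0 _ _] _]]]] := gammaE (introT andP (conj (lexx 0) ler01)).
pose V := rows_mx [tuple of u0 ++ v0].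
have V_free : row_free V by exact: basis_row_free basis0.
pose S t : 'M[R]_(n + n) := Jmx *m (A + t *: B).
pose T t := V *m (S t)^T *m pinvmx V.
have TV t : 0 <= t <= 1 -> T t *m V = V *m (S t)^T.
  move=> t01; apply: mulmxKpV; apply/row_subP => i.
  rewrite row_mul row_rows_mx -trmx_mul; apply: (basis_sub_rows basis0).
  apply: invU => //; rewrite -(span_basis basis0); apply/memv_span/mem_tnth.
pose TB := V *m (Jmx *m B)^T *m pinvmx V.
(* In the basis fixed at t = 0, T is affine in t; the indeterminate stands for t. *)
pose Tp : 'M[{poly R}]_(k + k) := map_mx polyC (T 0) + 'X *: map_mx polyC TB.
have TpE t : map_mx (horner_eval t) Tp = T t.
  have -> : T t = T 0 + t *: TB.
    rewrite /T /S scale0r addr0 mulmxDr -scalemxAr linearD linearZ /=.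
    by rewrite mulmxDr -scalemxAr mulmxDl -scalemxAl.
  by apply/matrixP => i j; rewrite !mxE /= /horner_eval !hornerE mulrC.
exists (char_poly (- (Tp *m Tp))); first exact/monic_neq0/char_poly_monic.
move=> t x t01; rewrite -horner_map_eval map_char_poly /= map_mxN map_mxM TpE.
have [_ [u [v [[basisUV _ _] uvP]]]] := gammaE t01.
(* The eigenvector basis may vary arbitrarily with t. Its coordinates [W *m pinvmx V] in the fixed
   basis diagonalize [- (T t *m T t)], and each eigenvalue occurs for u and for v, whence the
   square. *)
pose W := rows_mx [tuple of u ++ v].
pose D : 'rV[R]_(k + k) := row_mx (\row_i gamma i t ^+ 2) (\row_i gamma i t ^+ 2).
have WV : W *m pinvmx V *m V = W.
  apply: mulmxKpV; apply/row_subP => i; rewrite row_rows_mx (basis_sub_rows basis0) //.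
  by rewrite -(span_basis basisUV); apply/memv_span/mem_tnth.
have E_free : row_free (W *m pinvmx V).
  have /row_freeP[Winv WK] := basis_row_free basisUV.
  by apply/row_freeP; exists (V *m Winv); rewrite mulmxA WV.
have WS : W *m (S t)^T *m (S t)^T = - (diag_mx D *m W).
  apply/row_matrixP => i; rewrite !row_mul row_rows_mx -!trmx_mul.
  have -> : row i (- (diag_mx D *m W)) = - D 0 i *: row i W.
    by apply/rowP => j; rewrite mul_diag_mx !mxE mulNr.
  rewrite row_rows_mx -linearZ /=; congr (_^T).
  have eigS : S t *m (S t *m tnth [tuple of u ++ v] i) = - D 0 i *: tnth [tuple of u ++ v] i.
    case: (split_ordP i) => j ->; have [_ Su Sv] := eigenpair_sqr (uvP j).
      by rewrite tnth_lshift Su row_mxEl mxE.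
    by rewrite tnth_rshift Sv row_mxEr mxE.
  by rewrite eigS.
rewrite (@char_poly_diagonalizable _ _ _ (W *m pinvmx V) D) //.
  by rewrite big_split_ord /= expr2; congr (_ * _); apply: eq_bigr => i _;
    rewrite ?row_mxEl ?row_mxEr mxE.
move: (TV t t01) WV {E_free} => {TV}; move: (T t) (W *m pinvmx V) => Tt E TV WV.
apply: (row_free_inj V_free); rewrite /= -[RHS]mulmxA WV mulmxN mulNmx -!mulmxA TV.
by rewrite (mulmxA Tt) TV !mulmxA WV WS opprK.
Qed.
End SymplecticSpectrum.

(** * Breakpoints and conclusion *)

Lemma roots_seq (R : realFieldType) (p : {poly R}) : p != 0 ->
  exists s : seq R, forall x, p.[x] = 0 -> x \in s.
Proof.
elim: (size p) {-2}p (leqnn (size p)) => [q|n IH q qn q0].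
  by rewrite leqn0 size_poly_eq0 => ->.
have [[a /rootP/factor_theorem[q1 qE]]|noroot] := pselect (exists a, q.[a] = 0).
  have q10 : q1 != 0 by apply: contraNneq q0 => q10; rewrite qE q10 mul0r.
  have [|s sP] := IH q1 _ q10.
    by move: qn; rewrite qE size_Mmonic ?monicXsubC // size_XsubC addn2.
  exists (a :: s) => x; rewrite qE hornerM hornerXsubC inE => /eqP.
  by rewrite mulf_eq0 subr_eq0 => /orP[/eqP/sP ->|->]; rewrite ?orbT.
by exists [::] => x qx; case: noroot; exists x.
Qed.

Lemma piecewise_analytic_off_seq (R : realType) (f : R -> R) (s : seq R) :
  (forall x, 0 < x < 1 -> x \notin s -> real_analytic_at f x) -> piecewise_analytic f.
Proof.
move=> fs; pose s' := sort <=%R (undup [seq x <- s | 0 < x < 1]).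
have s'E x : (x \in s') = (0 < x < 1) && (x \in s).
  by rewrite mem_sort mem_undup mem_filter.
pose L := 0 :: rcons s' 1.
have sL : sorted <%R L.
  rewrite /L /= rcons_path; apply/andP; split.
    rewrite path_sortedE; last exact: lt_trans.
    rewrite sort_lt_sorted undup_uniq andbT; apply/allP => x.
    by rewrite s'E => /andP[/andP[]].
  have := mem_last 0 s'; rewrite inE => /orP[/eqP ->|]; first exact: ltr01.
  by rewrite s'E => /andP[/andP[]].
have szL : size L = (size s').+2 by rewrite /= size_rcons.
exists (size s').+1, (nth 1 L); split=> [//||l lr]; first by rewrite /= nth_rcons ltnn eqxx.
have ltL i j : (i < size L)%N -> (j < size L)%N -> (nth 1 L i < nth 1 L j) = (i < j)%N.
  by move=> iL jL; apply: lt_sorted_ltn_nth.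
have L0 : nth 1 L 0 = 0 by [].
have Lr : nth 1 L (size s').+1 = 1 by rewrite /= nth_rcons ltnn eqxx.
split=> [|x /andP[lx xl]]; first by rewrite ltL ?szL // ltnS ltnW.
have x01 : 0 < x < 1.
  apply/andP; split.
    apply: le_lt_trans lx; rewrite -[leLHS]L0 leNgt ltL ?szL // ?ltn0 //; exact: ltnW.
  by rewrite -[ltRHS]Lr (lt_le_trans xl) // leNgt ltL ?szL // -leqNgt.
apply: fs => //; apply/negP => xs.
(* A point of s in this interval would be an entry of L with index strictly between l and l + 1. *)
have xL : x \in L by rewrite inE mem_rcons inE s'E x01 xs !orbT.
move: lx xl; rewrite -(nth_index 1 xL) !ltL ?index_mem ?szL //; last exact: ltnW.
by rewrite ltnS => lx; rewrite leqNgt lx.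
Qed.

Theorem proposition3 (R : realType) (n k : nat) (A B : 'M[R]_(n + n))
    (U : {vspace 'cV[R]_(n + n)}) (gamma : 'I_k -> R -> R)
    (posA : posdef A) (posB : posdef B)
    (dimU : (\dim U = 2 * k)%N)
    (sympU : symplectic_subspace U)
    (invU : forall t : R, 0 <= t <= 1 ->
      invariant_subspace (Jmx *m (A + t *: B)) U)
    (gammaE : forall t : R, 0 <= t <= 1 ->
      associated_symplectic_eigenvalues (A + t *: B) U (fun i => gamma i t)) :
  forall i : 'I_k, piecewise_analytic (gamma i).
Proof.
have [Q Q0 QE] := symplectic_spectrum_poly invU gammaE.
have gamma_gt0 i t : 0 <= t <= 1 -> 0 < gamma i t.
  by move=> /gammaE[_ [u [v [_ /(_ i)/eigenpair_sqr[]]]]].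
have near01 (t0 : R) : 0 < t0 < 1 -> \forall t \near t0, 0 <= t <= 1.
  move=> t01; have : \forall t \near t0, t \in `]0, 1[ by apply: near_in_itvoo; rewrite in_itv.
  by apply: filterS => t; rewrite in_itv /= => /andP[/ltW -> /ltW ->].
have gamma_cont i (t0 : R) : 0 < t0 < 1 -> {for t0, continuous (gamma i)}.
  move=> t01; have t0' : 0 <= t0 <= 1 by case/andP: t01 => /ltW -> /ltW ->.
  (* The roots of Q are the squares of the gammas; positivity lets the square root transfer
     continuity back. *)
  have sq_cont : {for t0, continuous (fun t => gamma i t ^+ 2)}.
    apply: (@sorted_roots_continuous _ _ Q (fun j t => gamma j t ^+ 2)).
    apply: filterS (near01 _ t01) => t t'; split=> [a b ab|j|x].
    - have [gs _] := gammaE _ t'.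
      by rewrite lerXn2r ?nnegrE ?gs // ltW ?gamma_gt0.
    - exact: sqr_ge0.
    - exact: QE.
  have : Num.sqrt (gamma i t ^+ 2) @[t --> t0] --> Num.sqrt (gamma i t0 ^+ 2).
    exact: continuous_comp sq_cont (@sqrt_continuous _ _).
  rewrite [in X in _ --> X]sqrtr_sqr gtr0_norm ?gamma_gt0 //.
  apply: cvg_trans; apply: near_eq_cvg.
  apply: filterS (near01 _ t01) => t t'.
  by rewrite /= sqrtr_sqr gtr0_norm ?gamma_gt0.
have Q2E y t : (Q \Po 'X^2).[y%:P].[t] = Q.[(y ^+ 2)%:P].[t].
  by rewrite horner_comp hornerXn -polyC_exp.
(* The substitution precedes the square-free reduction, so that gamma itself, not its square, is the
   simple root. *)
have [|H [D D0 HD]] := @squarefree_part _ (Q \Po 'X^2).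
  by rewrite comp_poly_eq0 // size_polyXn.
have [s sD] := roots_seq D0.
have Hgamma i t : 0 <= t <= 1 -> D.[t] != 0 ->
    H.[(gamma i t)%:P].[t] = 0 /\ H^`().[(gamma i t)%:P].[t] != 0.
  move=> t01 Dt; apply: HD => //.
  by rewrite Q2E QE // (bigD1 i) //= subrr mul0r expr0n.
move=> i; apply: (@piecewise_analytic_off_seq _ _ s) => t0 t01 t0s.
have t0' : 0 <= t0 <= 1 by case/andP: t01 => /ltW -> /ltW ->.
have Dt0 : D.[t0] != 0 by apply: contraNneq t0s => /sD.
apply: (@implicit_real_analytic _ H); first exact: gamma_cont.
  have Dt : \forall t \near t0, D.[t] != 0 by exact: cvgr_neq0 (@continuous_horner _ D t0) Dt0.
  apply: filterS2 (near01 _ t01) Dt => t t' Dt.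
  by case: (Hgamma i t t' Dt).
by case: (Hgamma i t0 t0' Dt0).
Qed.
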